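(* Let $T$ be a telegraph process with parameters $\lambda>0$, $c>0$ and velocity process $V$, and let $t>0$. Then for every $n\in\mathbb{N}$ and $0=t_0<t_1<\dots<t_n<t$, with $x_0=0$ and $v_0=c$, one has, as an equality of measures in $(x_1,\dots,x_n)\in\mathbb{R}^n$, $$\mathsf{P}\Big\{T(t_1)\in dx_1,\dots,T(t_n)\in dx_n\,\Big|\,\min_{0\le s\le t}T(s)\ge 0\Big\}=\sum_{v_1,\dots,v_n\in\{-c,c\}}\ \prod_{k=1}^n f_{v_{k-1}}(x_k-x_{k-1},v_k,-x_{k-1},t_k-t_{k-1})\,dx_k\ \frac{m_{v_n}(-x_n,t-t_n)}{m_c(0,t)}.$$
   Context: Let $N=(N(s))_{s\ge0}$ be a homogeneous Poisson process of rate $\lambda>0$, and let $V(0)$ be independent of $N$ and uniformly distributed on $\{-c,c\}$, $c>0$. Set $V(s)=V(0)(-1)^{N(s)}$ and $T(s)=\int_0^sV(u)\,du$; $T$ is the telegraph process. Notation: for $v,v'\in\{-c,c\}$, $\beta\in\mathbb{R}$, $s>0$, $$f_{v'}(x,v,\beta,s)\,dx=\mathsf{P}\Big\{T(s)\in dx,\ V(s)=v,\ \min_{0\le u\le s}T(u)\ge\beta\,\Big|\,V(0)=v'\Big\},\qquad m_v(\beta,s)=\mathsf{P}\Big\{\min_{0\le u\le s}T(u)\ge\beta\,\Big|\,V(0)=v\Big\}.$$ Here $f_{v'}(x,v,\beta,s)\,dx$ is a notation for a finite measure on $\mathbb{R}$ in the variable $x$ (it may contain an atom at $x=v's$ in addition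 to an absolutely continuous part). Accordingly $f_{v_{k-1}}(x_k-x_{k-1},v_k,-x_{k-1},t_k-t_{k-1})\,dx_k$ denotes, for fixed $x_{k-1}$, the measure in $x_k$ given by $B\mapsto \mathsf{P}\{x_{k-1}+T(t_k-t_{k-1})\in B,\ V(t_k-t_{k-1})=v_k,\ \min_{0\le u\le t_k-t_{k-1}}T(u)\ge -x_{k-1}\mid V(0)=v_{k-1}\}$. The product of these kernels is integrated iteratively over $A_1\times\dots\times A_n$ (first in $x_n$, then $x_{n-1}$, ..., finally $x_1$). *)

(* Defs.v *)
From HB Require Import structures.
From mathcomp Require Import all_boot all_order all_algebra.
From mathcomp Require Import all_classical all_reals all_analysis.

Set Implicit Arguments.
Unset Strict Implicit.
Unset Printing Implicit Defensive.

Import Order.TTheory GRing.Theory Num.Theory.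
Import numFieldNormedType.Exports.

Local Open Scope classical_set_scope.
Local Open Scope ring_scope.

Section conditioning.
Context {R : realType} {d : measure_display} {Omega : measurableType d}.
Variable P : probability Omega R.
Local Open Scope ereal_scope.

Definition cond_prob (A B : set Omega) : \bar R := P (A `&` B) / P B.

Definition independent_systems (F G : set_system Omega) :=
  forall A B, F A -> G B -> P (A `&` B) = P A * P B.

End conditioning.

Section poisson_process.
Context {R : realType} {d : measure_display} {Omega : measurableType d}.
Variable P : probability Omega R.

Definition increment (N : R -> Omega -> nat) (r s : R) (w : Omega) : nat :=
  (N s w - N r w)%N.

(* Only the values of N at nonnegative times are constrained. The subtraction
   in [increment] is truncated, which is harmless since paths are
   nondecreasing. *)
Record poisson_process (lambda : R) (N : R -> Omega -> nat) : Prop := {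
  poisson_measurable : forall s : R, 0 <= s -> measurable_fun setT (N s);
  poisson_zero : forall w, N 0 w = 0%N;
  poisson_nondecreasing :
    forall (w : Omega) (r s : R), 0 <= r -> r <= s -> (N r w <= N s w)%N;
  poisson_right_continuous : forall (w : Omega) (s : R), 0 <= s ->
    ((N u w)%:R : R) @[u --> s^'+] --> ((N s w)%:R : R);
  poisson_independent_increments :
    forall (n : nat) (s : nat -> R) (B : nat -> set nat),
      0 <= s 0%N -> (forall i, (i < n)%N -> s i <= s i.+1) ->
      P (\bigcap_(i in `I_n) (increment N (s i) (s i.+1) @^-1` B i)) =
      (\prod_(i < n) P (increment N (s i) (s i.+1) @^-1` B i))%E;
  poisson_increment_law : forall (r s : R) (k : nat), 0 <= r -> r < s ->
    P (increment N r s @^-1` [set k]) = (poisson_pmf (lambda * (s - r)) k)%:E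
}.

(* The sigma-algebra generated by (N s)_{s >= 0}. *)
Definition sigma_process (N : R -> Omega -> nat) : set_system Omega :=
  <<s \bigcup_(s in `[0%R, +oo[) preimage_set_system setT (N s) measurable >>.

Definition sigma_rv (X : Omega -> R) : set_system Omega :=
  preimage_set_system setT X measurable.

Definition uniform_pm (c : R) (X : Omega -> R) :=
  P (X @^-1` [set c]) = (2^-1)%:E /\ P (X @^-1` [set - c]) = (2^-1)%:E.

End poisson_process.

Section telegraph.
Context {R : realType} {d : measure_display} {Omega : measurableType d}.
Variables (P : probability Omega R) (N : R -> Omega -> nat) (V0 : Omega -> R).

Definition velocity (s : R) (w : Omega) : R := V0 w * (-1) ^+ N s w.

Definition telegraph (s : R) (w : Omega) : R :=
  \int[lebesgue_measure]_(u in `[0, s]) velocity u w.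

(* The infimum is attained: the paths of [telegraph] are continuous. *)
Definition min_telegraph (s : R) (w : Omega) : R :=
  inf [set telegraph u w | u in `[0, s]].

(* f_{v'}(x, v, beta, s) dx, as a set function of the variable x. *)
Definition f_meas (v' v beta s : R) : set R -> \bar R := fun B =>
  cond_prob P
    [set w | [/\ B (telegraph s w), velocity s w = v
               & beta <= min_telegraph s w]]
    [set w | velocity 0 w = v'].

Definition m_prob (v beta s : R) : \bar R :=
  cond_prob P [set w | beta <= min_telegraph s w] [set w | velocity 0 w = v].

(* f_{v'}(y - x, v, - x, s) dy, as a set function of the variable y: the image
   of f_{v'}(z, v, - x, s) dz under z |-> x + z. *)
Definition f_kernel (v' v s x : R) : set R -> \bar R :=
  pushforward (f_meas v' v (- x) s) (fun z => x + z).

End telegraph.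

(* With K k x the measure in x_k given x_{k-1} = x, [iter_integral K A g k m x]
   is the integral over x_{k+1} in A (k+1), ..., x_{k+m} in A (k+m) (innermost
   x_{k+m}) of g (x_{k+m}), given x_k = x. *)
Fixpoint iter_integral {R : realType} (K : nat -> R -> set R -> \bar R)
    (A : nat -> set R) (g : R -> \bar R) (k m : nat) (x : R) : \bar R :=
  match m with
  | 0%N => g x
  | m'.+1 => (\int[K k.+1 x]_(y in A k.+1) iter_integral K A g k.+1 m' y)%E
  end.

Definition vel {R : realType} (c : R) (b : bool) : R := if b then c else - c.

(* Main.v *)
Require Import Defs.
From HB Require Import structures.
From mathcomp Require Import all_boot all_order all_algebra.
From mathcomp Require Import all_classical all_reals all_analysis.
From mathcomp Require Import measurable_realfun ring lra.

Set Implicit Arguments.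
Unset Strict Implicit.
Unset Printing Implicit Defensive.

Import Order.TTheory GRing.Theory Num.Theory.
Import numFieldNormedType.Exports.

Local Open Scope classical_set_scope.
Local Open Scope ring_scope.

(* On the event [V(0) = v] the process is [T = v S], where [S(s)] is the integral
   of [(-1)^N] over [0, s], a functional of the Poisson path. Stationarity and
   independence of the increments of [N] make the path after time [r], recentred
   at [N(r)], a copy of [N] independent of the path before [r]; moreover
   [T(r + u) - T(r) = V(r) S(u)] with [S] evaluated on the recentred path. Fix
   velocities [v_1, ..., v_n] and let [p k x] be the probability that the process
   started from [x] with velocity [v_k] at time [t_k] visits [A_j] with velocity
   [v_j] at each time [t_j], [j > k], and stays nonnegative up to time [t].
   Conditioning on the position at time [t_(k+1)] yields
   [p k x = \int f_kernel(x, dy) p (k+1) y] over [A_(k+1)], and summing [p 0 0]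
   over all velocities gives the joint probability. *)

(** * Integrals of signs along a nondecreasing path *)

Lemma measurable_fun_nat d (T : measurableType d) (D : set T) (f : T -> nat) :
  measurable D -> (forall k, measurable (D `&` f @^-1` [set k])) ->
  measurable_fun D f.
Proof.
move=> mD mf _ B _.
rewrite (_ : D `&` _ = \bigcup_(k in B) (D `&` f @^-1` [set k])).
  by apply: bigcup_measurable => k _.
apply/seteqP; split=> [x [Dx Bfx]|x [k Bk [Dx fxk]]]; first by exists (f x).
by split=> //; rewrite /preimage /= fxk.
Qed.

Section paths.
Context {R : realType}.
Implicit Types (p : R -> nat) (a b h r s u : R).

Definition nondecreasing_path p :=
  forall r s, 0 <= r -> r <= s -> (p r <= p s)%N.

Definition path_sign p u : R := (-1) ^+ p u.

Definition sign_integral p a b : R :=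
  \int[lebesgue_measure]_(u in `[a, b]) path_sign p u.

(** Right endpoints of [n.+1] equal cells: the sum reads [p] at finitely many times, hence is
    measurable in [p]. *)
Definition riemann_sum p a s n : R :=
  s / n.+1%:R * \sum_(j < n.+1) path_sign p (a + s / n.+1%:R * j.+1%:R).

Definition shift_path r p : R -> nat := fun u => (p (r + u)%R - p r)%N.

Definition stop_path r p : R -> nat := fun u => p (Num.min u r).

Lemma norm_path_sign p u : `|path_sign p u| = 1.
Proof. by rewrite /path_sign normrX normrN1 expr1n. Qed.

(** By monotonicity the level sets of [p] on the half-line are intervals. *)
Lemma measurable_path_sign p : nondecreasing_path p ->
  measurable_fun (`[0, +oo[ : set R) (path_sign p).
Proof.
move=> np; rewrite (_ : path_sign p = (fun n => (-1) ^+ n : R) \o p)//.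
apply: measurableT_comp => //; apply: measurable_fun_nat => // k.
apply: is_interval_measurable => x y /= [].
rewrite !in_itv/= !andbT => x0 px [y0 py] z /andP[xz zy].
have z0 := le_trans x0 xz; split; first by rewrite in_itv/= andbT.
by apply/eqP; rewrite eqn_leq -{1}py -{1}px !np.
Qed.

Lemma integrable_path_sign p (i : interval R) a b :
  0 <= a -> [set` i] `<=` `[a, b] -> nondecreasing_path p ->
  lebesgue_measure.-integrable [set` i] (EFin \o path_sign p).
Proof.
move=> a0 iab np; apply: (@integrableS _ _ _ lebesgue_measure (`[a, b]%classic : set R)) => //.
apply: (@le_integrable _ _ _ _ _ _ _ (EFin \o cst 1)) => //.
- apply/measurable_EFinP; apply: measurable_funS (measurable_path_sign np) => //.
  by apply: subset_itv; rewrite ?bnd_simp.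
- by move=> x _ /=; rewrite lee_fin norm_path_sign normr1.
- apply/integrableP; split; first exact/measurable_EFinP.
  under eq_integral do rewrite /= normr1.
  rewrite integral_cst//= mul1e lebesgue_measure_itv/=.
  by case: ifP => _; rewrite ?EFinB -?EFinD ltry.
Qed.

Lemma sign_integral_setU p a b e : nondecreasing_path p ->
  0 <= a -> a <= b -> b <= e ->
  sign_integral p a e =
  sign_integral p a b + \int[lebesgue_measure]_(u in `]b, e]) path_sign p u.
Proof.
move=> np a0 ab be; rewrite /sign_integral.
rewrite -(@Rintegral_itvB _ (path_sign p) (BLeft a) (BRight e) b) ?bnd_simp//.
  by rewrite addrC subrK.
exact: (@integrable_path_sign p `[a, e] a e a0).
Qed.

Lemma sub_itv_oc_cc a b : [set` `]a, b]] `<=` [set` `[a, b]].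
Proof. by apply: subset_itvr; rewrite bnd_simp. Qed.

Lemma lebesgue_itv_oc a b : a <= b -> fine (lebesgue_measure `]a, b]) = b - a.
Proof.
move=> ab; rewrite lebesgue_measure_itv/= lte_fin.
case: ltP => //= ba; apply/eqP.
by rewrite eq_sym subr_eq0 eq_le ab ba.
Qed.

Lemma norm_sign_integral_oc p a b : nondecreasing_path p ->
  0 <= a -> a <= b ->
  `|\int[lebesgue_measure]_(u in `]a, b]) path_sign p u| <= b - a.
Proof.
move=> np a0 ab.
apply: (le_trans (le_normr_Rintegral _ _)) => //.
  exact: (integrable_path_sign a0 (@sub_itv_oc_cc a b) np).
under eq_Rintegral do rewrite norm_path_sign.
by rewrite Rintegral_cst// mul1r lebesgue_itv_oc.
Qed.

(** If [p] takes the same value at both ends of the cell, the sign is constant there and the error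
    is zero. Otherwise [p] grows by at least one, and the integral and its approximation are each at
    most [h] in absolute value. *)
Lemma riemann_step p a h : nondecreasing_path p -> 0 <= a -> 0 <= h ->
  `|\int[lebesgue_measure]_(u in `]a, a + h]) path_sign p u
     - h * path_sign p (a + h)| <= 2 * h * ((p (a + h))%:R - (p a)%:R).
Proof.
move=> np a0 h0; have aah : a <= a + h by rewrite lerDl.
have := np _ _ a0 aah; rewrite leq_eqVlt => /predU1P[pE|plt].
  have -> : \int[lebesgue_measure]_(u in `]a, a + h]) path_sign p u =
            h * path_sign p (a + h).
    transitivity (\int[lebesgue_measure]_(u in `]a, a + h])
        (path_sign p (a + h))).
      apply: eq_Rintegral => x; rewrite inE/= in_itv/= => /andP[ax xh].
      congr (_ ^+ _); apply/eqP; rewrite eqn_leq np ?(le_trans a0 (ltW ax))//=.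
      by rewrite -pE np// ltW.
    by rewrite Rintegral_cst// lebesgue_itv_oc// mulrC addrAC subrr add0r.
  by rewrite subrr normr0 pE subrr mulr0.
apply: (le_trans (ler_normB _ _)); rewrite normrM norm_path_sign ger0_norm//.
have := norm_sign_integral_oc np a0 aah; rewrite addrAC subrr add0r => H.
apply: (@le_trans _ _ (2 * h)); first by rewrite mulr1 mulr_natl mulr2n lerD.
rewrite ler_peMr ?mulr_ge0// -natrB ?(ltnW plt)//.
by rewrite (ler_nat R 1) subn_gt0.
Qed.

(* A cell contributes an error only if the path jumps inside it, so the total
   error is at most the mesh times the number of jumps. *)
Lemma riemann_error p a h n : nondecreasing_path p -> 0 <= a -> 0 <= h ->
  `|sign_integral p a (a + h * n%:R)
     - h * \sum_(j < n) path_sign p (a + h * j.+1%:R)|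
  <= 2 * h * ((p (a + h * n%:R))%:R - (p a)%:R).
Proof.
move=> np a0 h0; elim: n => [|n IH].
  rewrite mulr0 addr0 big_ord0 mulr0 subrr mulr0 subr0.
  by rewrite /sign_integral set_itv1 Rintegral_set1 normr0.
have hn0 : 0 <= h * n%:R by rewrite mulr_ge0.
rewrite big_ord_recr/= (@sign_integral_setU _ a (a + h * n%:R))//; last 2 first.
- by rewrite lerDl.
- by rewrite lerD2l ler_wpM2l// ler_nat.
have E : a + h * n.+1%:R = a + h * n%:R + h by rewrite -addn1 natrD; ring.
have := @riemann_step p (a + h * n%:R) h np (addr_ge0 a0 hn0) h0.
rewrite -E => S.
rewrite mulrDr opprD addrACA; apply: (le_trans (ler_normD _ _)).
apply: (le_trans (lerD IH S)); rewrite -mulrDr.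
by rewrite le_eqVlt; apply/orP; left; apply/eqP; ring.
Qed.

Lemma cvg_riemann_sum p a s : nondecreasing_path p -> 0 <= a -> 0 <= s ->
  riemann_sum p a s @ \oo --> sign_integral p a (a + s).
Proof.
move=> np a0 s0; apply/cvgrPdist_le => e e0.
pose C : R := 2 * s * ((p (a + s))%:R - (p a)%:R).
have : C * n.+1%:R^-1 @[n --> \oo] --> 0.
  by rewrite -(mulr0 C); apply: cvgM; [exact: cvg_cst|exact: cvg_harmonic].
move=> /cvgrPdist_le/(_ _ e0); apply: filterS => n; rewrite sub0r normrN => Ce.
have n0 : 0 <= s / n.+1%:R :> R by rewrite divr_ge0.
have := @riemann_error p a (s / n.+1%:R) n.+1 np a0 n0.
rewrite divfK ?pnatr_eq0// => /le_trans; apply.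
apply: le_trans (le_trans (ler_norm _) Ce).
by rewrite le_eqVlt; apply/orP; left; apply/eqP; rewrite /C; ring.
Qed.

Lemma sign_shift_path p r u : nondecreasing_path p -> 0 <= r -> 0 <= u ->
  path_sign p (r + u) = path_sign p r * path_sign (shift_path r p) u.
Proof.
move=> np r0 u0; rewrite /path_sign /shift_path -exprD addnC subnK//.
by rewrite np// lerDl.
Qed.

Lemma nondecreasing_shift_path p r : nondecreasing_path p -> 0 <= r ->
  nondecreasing_path (shift_path r p).
Proof.
move=> np r0 u s u0 us; apply: leq_sub2r; apply: np; last by rewrite lerD2l.
exact: addr_ge0.
Qed.

(* Both sides are limits of the same Riemann sums. *)
Lemma sign_integral_shift p r u : nondecreasing_path p -> 0 <= r -> 0 <= u ->
  sign_integral p r (r + u) =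
  path_sign p r * sign_integral (shift_path r p) 0 u.
Proof.
move=> np r0 u0.
have H := cvg_riemann_sum np r0 u0.
have := cvg_riemann_sum (nondecreasing_shift_path np r0) (lexx 0) u0.
rewrite add0r => /(@cvgM _ _ _ _ _ _ _ _ (@cvg_cst _ (path_sign p r) nat \oo _)).
move=> H'; apply/esym/(cvg_unique _ _ H) => //; apply: cvg_trans H'.
apply: near_eq_cvg; near=> n; rewrite /riemann_sum /=.
rewrite [LHS]mulrCA; congr (_ * _); rewrite mulr_sumr; apply: eq_bigr => j _.
by rewrite -sign_shift_path ?add0r// mulr_ge0// divr_ge0.
Unshelve. all: by end_near. Qed.

Lemma sign_integral_split p r u : nondecreasing_path p -> 0 <= r -> 0 <= u ->
  sign_integral p 0 (r + u) =
  sign_integral p 0 r + path_sign p r * sign_integral (shift_path r p) 0 u.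
Proof.
move=> np r0 u0; rewrite -sign_integral_shift//.
have ru : r <= r + u by rewrite lerDl.
rewrite (@sign_integral_setU _ 0 r)//; congr (_ + _).
rewrite /sign_integral Rintegral_itv_obnd_cbnd//.
exact: (integrable_path_sign r0 (@sub_itv_oc_cc r (r + u)) np).
Qed.

Lemma sign_integral_lip p a b : nondecreasing_path p -> 0 <= a -> a <= b ->
  `|sign_integral p 0 b - sign_integral p 0 a| <= b - a.
Proof.
move=> np a0 ab; rewrite (@sign_integral_setU _ 0 a)// addrAC subrr add0r.
exact: norm_sign_integral_oc.
Qed.

End paths.

(** * Measurability on path space *)

Section path_space.
Context {R : realType}.

(** Lists may repeat a time, so concatenating two lists yields the intersection of the cylinders. *)
Definition cylinder (l : seq (R * nat)) : set (R -> nat) :=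
  [set p | forall q, q \in l -> p q.1 = q.2].

Definition cylinders : set_system (R -> nat) :=
  [set C | exists2 l : seq (R * nat),
     (forall q, q \in l -> 0 <= q.1) & C = cylinder l].

Definition path_space : Type := g_sigma_algebraType cylinders.

HB.instance Definition _ := Measurable.on path_space.

Lemma setI_closed_cylinders : setI_closed cylinders.
Proof.
move=> _ _ [l1 l1_ge0 ->] [l2 l2_ge0 ->]; exists (l1 ++ l2).
  by move=> q; rewrite mem_cat => /orP[/l1_ge0|/l2_ge0].
apply/seteqP; split=> p.
  by move=> [p1 p2] q; rewrite mem_cat => /orP[/p1|/p2].
by move=> p12; split=> q ql; apply: p12; rewrite mem_cat ql ?orbT.
Qed.

Lemma cylinder_nil : cylinder [::] = setT.
Proof. by apply/seteqP; split. Qed.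

Lemma cylindersT : cylinders setT.
Proof. by exists [::]; rewrite ?cylinder_nil. Qed.

Lemma measurable_fun_path_space d (T : measurableType d)
    (f : T -> path_space) :
  (forall u, 0 <= u -> measurable_fun setT (fun w => f w u)) ->
  measurable_fun setT f.
Proof.
move=> mf; apply: (@measurability _ _ T path_space setT f cylinders) => //.
move=> _ [_ [l l_ge0 ->] <-].
rewrite setTI (_ : _ @^-1` _ =
    \bigcap_(q in [set` l]) ((fun w => f w q.1) @^-1` [set q.2])).
  apply: fin_bigcap_measurable => [|q ql]; first exact: finite_seq.
  by rewrite -[X in measurable X]setTI; apply: mf => //; exact: l_ge0.
by apply/seteqP; split=> w /= fl q; apply: fl.
Qed.

Lemma measurable_coord (u : R) : 0 <= u ->
  measurable_fun setT (fun p : path_space => p u).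
Proof.
move=> u0; apply: measurable_fun_nat => // k; rewrite setTI.
apply: sub_sigma_algebra; exists [:: (u, k)] => [q|]; first by rewrite inE => /eqP->.
apply/seteqP; split=> p /= puk; first by move=> q; rewrite inE => /eqP->.
by apply: (puk (u, k)); rewrite mem_head.
Qed.

Lemma measurable_stop_path (r : R) : 0 <= r ->
  measurable_fun setT (stop_path r : path_space -> path_space).
Proof.
move=> r0; apply: measurable_fun_path_space => u u0.
by apply: measurable_coord; rewrite le_min u0.
Qed.

Lemma measurable_shift_path (r : R) : 0 <= r ->
  measurable_fun setT (shift_path r : path_space -> path_space).
Proof.
move=> r0; apply: measurable_fun_path_space => u u0.
have mru := measurable_coord (addr_ge0 r0 u0); have mr := measurable_coord r0.
exact: (measurable_fun_subn mru mr).
Qed.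

(* The Riemann sums converge on nondecreasing paths only; the superior limit
   extends the signed integral to a measurable function of all paths. *)
Definition displacement (s : R) (p : path_space) : R :=
  fine (limn_esup (fun n => (riemann_sum p 0 s n)%:E)).

Lemma measurable_path_sign_coord (u : R) : 0 <= u ->
  measurable_fun setT (fun p : path_space => path_sign p u : R).
Proof.
move=> u0; apply: (measurableT_comp (f := fun n : nat => (-1) ^+ n : R)) => //.
exact: measurable_coord.
Qed.

Lemma measurable_displacement (s : R) : 0 <= s ->
  measurable_fun setT (displacement s).
Proof.
move=> s0; apply: measurableT_comp => //; apply: measurable_fun_limn_esup => n.
apply/measurable_EFinP; apply: measurable_funM => //.
apply: measurable_sum => j; apply: measurable_path_sign_coord.
by rewrite add0r mulr_ge0// divr_ge0.
Qed.

Lemma displacementE (s : R) (p : path_space) : nondecreasing_path p ->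
  0 <= s -> displacement s p = sign_integral p 0 s.
Proof.
move=> np s0; rewrite /displacement.
have := cvg_riemann_sum np (lexx 0) s0; rewrite add0r => H.
have /cvg_limn_einf_sup[_ -> //] : (riemann_sum p 0 s n)%:E @[n --> \oo] -->
    (sign_integral p 0 s)%:E.
by apply: cvg_EFin => //; exact: nearW.
Qed.

(** The Riemann sums read the path at times at most [s] only, so the equality holds for arbitrary
    paths. *)
Lemma displacement_stop (r s : R) (p : path_space) : 0 <= s -> s <= r ->
  displacement s (stop_path r p) = displacement s p.
Proof.
move=> s0 sr; rewrite /displacement; congr (fine (limn_esup _)).
apply/funext => n; congr (_%:E); congr (_ * _); apply: eq_bigr => j _.
congr (_ ^+ _); rewrite /stop_path (min_idPl _)// add0r (le_trans _ sr)//.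
rewrite -mulrA ler_piMr// mulrC ler_pdivrMr ?ltr0n// mul1r ler_nat.
exact: ltn_ord.
Qed.

(** Nonnegativity is asked on the equidistant grids of [[0, s]]: a countable intersection, hence
    measurable, which for nondecreasing paths controls the whole interval by continuity. *)
Definition stays_nonneg (v s x : R) : set path_space :=
  [set p | forall n j : nat, (j <= n.+1)%N ->
     0 <= x + v * displacement (s / n.+1%:R * j%:R) p].

Lemma grid_le (s : R) (n j : nat) : 0 <= s -> (j <= n.+1)%N ->
  s / n.+1%:R * j%:R <= s.
Proof.
by move=> s0 jn; rewrite -mulrA ler_piMr// mulrC ler_pdivrMr ?ltr0n// mul1r ler_nat.
Qed.

Lemma grid_ge0 (s : R) (n j : nat) : 0 <= s -> 0 <= s / n.+1%:R * j%:R.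
Proof. by move=> s0; rewrite mulr_ge0// divr_ge0. Qed.

Lemma stays_nonneg_stop (v r x : R) (p : path_space) : 0 <= r ->
  stays_nonneg v r x (stop_path r p) = stays_nonneg v r x p.
Proof.
move=> r0; apply/propext; split=> H n j jn; have := H _ _ jn;
  by rewrite displacement_stop ?grid_le ?grid_ge0.
Qed.

(** Positions are Lipschitz in time with constant [|v|]: a negative value at [u] forces a negative
    value at a nearby grid point once the mesh is fine enough. *)
Lemma stays_nonnegP (v s x : R) (p : path_space) : nondecreasing_path p ->
  0 <= s ->
  stays_nonneg v s x p <->
  (forall u, 0 <= u <= s -> 0 <= x + v * sign_integral p 0 u).
Proof.
move=> np s0; split=> [H u /andP[u0 us]|H n j jn]; last first.
  by rewrite displacementE ?grid_ge0// H// grid_ge0 ?grid_le.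
rewrite leNgt; apply/negP => neg.
(* The endpoint [u = s] is a point of the one-cell grid. If [u < s], then [s] is positive and one
   can divide by the mesh. *)
move: us; rewrite le_eqVlt => /predU1P[us|us].
  have := H 0%N 1%N (leqnn _); rewrite divr1 mulr1 displacementE// -us.
  by rewrite leNgt neg.
have s_gt0 := le_lt_trans u0 us.
pose e := - (x + v * sign_integral p 0 u).
have e0 : 0 < e by rewrite oppr_gt0.
(* With this mesh the position changes over one cell by less than the deficit [e]; [j] below indexes
   the last grid point not after [u]. *)
pose n := Num.truncn (`|v| * s / e).
have nlt : `|v| * s / e < n.+1%:R.
  by apply: truncnS_gt.
have hn0 : 0 < s / n.+1%:R by rewrite divr_gt0.
pose j := Num.truncn (u / (s / n.+1%:R)).
have uj0 : 0 <= u / (s / n.+1%:R) by rewrite divr_ge0// ltW.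
have /andP[j1 j2] := truncn_itv uj0.
rewrite -/j in j1 j2.
have ju : s / n.+1%:R * j%:R <= u by rewrite mulrC -ler_pdivlMr.
have uj : u - s / n.+1%:R * j%:R <= s / n.+1%:R.
  move: j2; rewrite ltr_pdivrMr// -addn1 natrD mulrDl mul1r mulrC => /ltW.
  by rewrite lerBlDl.
have jn : (j <= n.+1)%N.
  rewrite -(ler_nat R); apply: (le_trans j1).
  by rewrite invf_div mulrA ler_pdivrMr// mulrC ler_wpM2l// ltW.
have := H n j jn; rewrite displacementE ?grid_ge0//.
have gl := sign_integral_lip np (grid_ge0 n j s0) ju.
apply/negP; rewrite -ltNge.
have : `|v * (sign_integral p 0 u - sign_integral p 0 (s / n.+1%:R * j%:R))| < e.
  rewrite normrM; apply: (@le_lt_trans _ _ (`|v| * (s / n.+1%:R))).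
    by rewrite ler_wpM2l// (le_trans gl).
  by rewrite mulrA ltr_pdivrMr// [e * _]mulrC -ltr_pdivrMr.
rewrite /e ltr_norml; lra.
Qed.

End path_space.

(** * The law of the Poisson path *)

Section poisson_increments.
Context {R : realType} {d : measure_display} {Omega : measurableType d}.
Variables (P : probability Omega R) (lambda : R) (N : R -> Omega -> nat).
Hypothesis N_poisson : poisson_process P lambda N.

Lemma poisson_path_nondecreasing w : nondecreasing_path (N^~ w).
Proof. exact: (poisson_nondecreasing N_poisson). Qed.

(** Each entry pairs the end time of an increment with its allowed values, and the next increment
    starts there; recursion on the list replaces the indexed sequences of
    [poisson_independent_increments]. *)
Fixpoint increments_in (a : R) (l : seq (R * set nat)) (w : Omega) : Prop :=
  if l is q :: l' then q.2 (increment N a q.1 w) /\ increments_in q.1 l' w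
  else True.

Fixpoint increments_prob (a : R) (l : seq (R * set nat)) : \bar R :=
  if l is q :: l' then
    (P (increment N a q.1 @^-1` q.2) * increments_prob q.1 l')%E
  else 1%E.

Lemma increments_in_cat a l1 l2 w : increments_in a (l1 ++ l2) w <->
  increments_in a l1 w /\ increments_in (last a (map fst l1)) l2 w.
Proof.
elim: l1 a => [|q l1 IH] a /=; first by split=> [|[]].
by rewrite IH and_assoc.
Qed.

Lemma increments_prob_cat a l1 l2 : increments_prob a (l1 ++ l2) =
  (increments_prob a l1 * increments_prob (last a (map fst l1)) l2)%E.
Proof. by elim: l1 a => [|q l1 IH] a /=; rewrite ?mul1e// IH muleA. Qed.

Lemma prob_increments_in a l : 0 <= a -> path <=%R a (map fst l) ->
  P [set w | increments_in a l w] = increments_prob a l.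
Proof.
move=> a0 al; pose s := nth 0 (a :: map fst l).
pose B := nth setT (map snd l).
have sl i : (i < size l)%N -> s i <= s i.+1.
  by move=> il; move/(pathP 0) : al => /(_ i); rewrite size_map => /(_ il).
have := @poisson_independent_increments _ _ _ _ _ _ N_poisson _ s B a0 sl.
rewrite (_ : \bigcap_(i in _) _ = [set w | increments_in a l w]) => [->|].
  rewrite /s /B {s B sl a0 al}; elim: l a => [|q l IH] a /=.
    by rewrite big_ord0.
  by rewrite big_ord_recl /= -IH.
apply/seteqP; rewrite /s /B {s B sl a0 al}; split=> w.
- elim: l a => [//|q l IH] a /= H; split; first exact: (H 0%N).
  by apply: IH => i /= il; exact: (H i.+1).
- elim: l a => [//|q l IH] a /= [H1 /IH H2] [|i] //= il.
  exact: (H2 i).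
Qed.

(** Stationarity: the condition fixes the increment to [k - p], or has no solution when [k < p], and
    the Poisson law depends on the length [u - a] only. Length zero is treated apart because the law
    is given for [r < s]. *)
Lemma increment_prob_shift r a u p k : 0 <= r -> 0 <= a -> a <= u ->
  P (increment N (r + a) (r + u) @^-1` [set j | (p + j)%N = k]) =
  P (increment N a u @^-1` [set j | (p + j)%N = k]).
Proof.
move=> r0 a0; rewrite le_eqVlt => /predU1P[<-|au].
  suff E x : increment N x x = cst 0%N by rewrite !E.
  by apply/funext => w; rewrite /increment subnn.
have [pk|kp] := leqP p k; last first.
  suff -> : [set j | (p + j)%N = k] = set0 by rewrite !preimage_set0.
  apply/seteqP; split=> // j /= pjk; move: kp.
  by rewrite -pjk ltnNge leq_addr.
have -> : [set j | (p + j)%N = k] = [set (k - p)%N].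
  apply/seteqP; split=> j /=; first by move=> <-; rewrite addKn.
  by move=> ->; rewrite subnKC.
rewrite !(poisson_increment_law N_poisson) ?ltrD2l ?addr_ge0//.
by rewrite opprD addrACA subrr add0r.
Qed.

(* A path that starts at [p] and takes the value [k] at time [u] has an increment
   [j] with [p + j = k]; stating it additively makes a decrease impossible. *)
Fixpoint cylinder_increments (r : R) (p : nat) (l : seq (R * nat)) :
    seq (R * set nat) :=
  if l is q :: l' then
    (r + q.1, [set j | (p + j)%N = q.2]) :: cylinder_increments r q.2 l'
  else [::].

Lemma fst_cylinder_increments r p l :
  map fst (cylinder_increments r p l) = map (+%R r) (map fst l).
Proof. by elim: l p => //= q l IH p; rewrite IH. Qed.

Lemma path_cylinder_increments r p a l :
  path <=%R (r + a) (map fst (cylinder_increments r p l)) =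
  path <=%R a (map fst l).
Proof.
rewrite fst_cylinder_increments path_map; apply: eq_path => x y /=.
by rewrite lerD2l.
Qed.

Lemma increments_prob_shift r a p l : 0 <= r -> 0 <= a ->
  path <=%R a (map fst l) ->
  increments_prob (r + a) (cylinder_increments r p l) =
  increments_prob a (cylinder_increments 0 p l).
Proof.
move=> r0; elim: l a p => [//|q l IH] a p a0 /= /andP[aq ql].
by rewrite add0r increment_prob_shift// IH// (le_trans a0).
Qed.

(** Here [p] is the value of the shifted path at time [a]; the induction carries it along, so that
    prescribing the next value amounts to prescribing the next increment. *)
Lemma increments_in_cylinder r a p l w : 0 <= r -> 0 <= a ->
  path <=%R a (map fst l) -> (N (r + a) w - N r w)%N = p ->
  increments_in (r + a) (cylinder_increments r p l) w <->
  cylinder l (shift_path r (N^~ w)).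
Proof.
move=> r0; elim: l a p => [|q l IH] a p a0 //=.
move=> /andP[aq ql] Nap.
have q0 := le_trans a0 aq.
have ra0 := addr_ge0 r0 a0.
have Nra : (N r w <= N (r + a)%R w)%N.
  by apply: poisson_path_nondecreasing => //; rewrite lerDl.
have Naq : (N (r + a)%R w <= N (r + q.1)%R w)%N.
  by apply: poisson_path_nondecreasing => //; rewrite lerD2l.
have E : (p + increment N (r + a) (r + q.1) w)%N = shift_path r (N^~ w) q.1.
  by rewrite /increment /shift_path -Nap addnC addnBA// subnK.
split.
- move=> [/=]; rewrite E => Eq H z; rewrite inE => /predU1P[->//|zl].
  exact: (proj1 (IH q.1 q.2 q0 ql Eq) H).
- move=> H; have Eq := H q (mem_head _ _); split; first by rewrite /= E.
  by apply: (proj2 (IH q.1 q.2 q0 ql Eq)) => z zl; apply: H; rewrite inE zl orbT.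
Qed.

Definition time_le (x y : R * nat) := x.1 <= y.1.

(** Increments are taken in chronological order, hence the sorting; a repeated time gives an
    increment over an interval of length zero. *)
Definition cylinder_prob (l : seq (R * nat)) : \bar R :=
  increments_prob 0 (cylinder_increments 0 0 (sort time_le l)).

Lemma cylinder_sort (l : seq (R * nat)) : cylinder (sort time_le l) = cylinder l.
Proof.
by apply/seteqP; split=> p H q; have := H q; rewrite mem_sort.
Qed.

Lemma path_sort_time l : (forall q, q \in l -> 0 <= q.1) ->
  path <=%R 0 (map fst (sort time_le l)).
Proof.
move=> l0; rewrite path_min_sorted; last first.
  by apply/allP => _ /mapP[q ql ->]; apply: l0; rewrite -(mem_sort time_le).
rewrite sorted_map; apply: (@sort_sorted _ time_le) => x y.
exact: le_total.
Qed.

(** The constraints before and after [r] concern successive increments, so the probability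
    factorizes; stationarity moves the second group back to time 0. *)
Lemma prob_cylinder2 r l1 l2 : 0 <= r ->
  (forall q, q \in l1 -> 0 <= q.1 <= r) -> (forall q, q \in l2 -> 0 <= q.1) ->
  P [set w | cylinder l1 (N^~ w) /\ cylinder l2 (shift_path r (N^~ w))] =
  (cylinder_prob l1 * cylinder_prob l2)%E.
Proof.
move=> r0 l1r l2_ge0; rewrite -(cylinder_sort l1) -(cylinder_sort l2).
have l1_ge0 q : q \in l1 -> 0 <= q.1 by move=> /l1r/andP[].
have := path_sort_time l2_ge0; have := path_sort_time l1_ge0.
rewrite /cylinder_prob; set s1 := sort _ l1; set s2 := sort _ l2 => ps1 ps2.
have lastr : last 0 (map fst s1) <= r.
  have := mem_last 0 (map fst s1); rewrite inE => /predU1P[->//|/mapP[q]].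
  by rewrite mem_sort => /l1r/andP[_ +] ->.
(* The unconstrained entry [(r, setT)] leads from the last time of [l1] to [r] and contributes a
   factor 1. *)
pose L := cylinder_increments 0 0 s1 ++ (r, setT) :: cylinder_increments r 0 s2.
have E1 : map fst (cylinder_increments 0 0 s1) = map fst s1.
  by rewrite fst_cylinder_increments -[RHS]map_id; apply: eq_map => x; rewrite add0r.
have pL : path <=%R 0 (map fst L).
  rewrite map_cat cat_path E1 ps1 /= lastr /=.
  by rewrite -[X in path _ X _]addr0 path_cylinder_increments.
have := prob_increments_in (lexx 0) pL; rewrite increments_prob_cat /= E1.
rewrite preimage_setT probability_setT mul1e.
have -> : increments_prob r (cylinder_increments r 0 s2) =
    increments_prob 0 (cylinder_increments 0 0 s2).
  by rewrite -(@increments_prob_shift r 0)// addr0.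
move=> <-.
congr (P _); apply/seteqP; split=> w /=.
- move=> [H1 H2]; rewrite increments_in_cat; split; last split => //=.
    rewrite -[X in increments_in X](addr0 0 : 0 + 0 = 0 :> R); apply/increments_in_cylinder => //.
      by rewrite add0r subnn.
    move=> q /H1; rewrite /shift_path add0r.
    by rewrite (poisson_zero N_poisson) subn0.
  rewrite -[X in increments_in X](addr0 r : r + 0 = r); apply/increments_in_cylinder => //.
  by rewrite addr0 subnn.
- rewrite increments_in_cat /= => -[H1 [_ H2]]; split.
    move: H1; rewrite -[X in increments_in X](addr0 0 : 0 + 0 = 0 :> R) increments_in_cylinder//.
      move=> H q /H; rewrite /shift_path add0r.
      by rewrite (poisson_zero N_poisson) subn0.
    by rewrite add0r subnn.
  move: H2; rewrite -[X in increments_in X](addr0 r : r + 0 = r) increments_in_cylinder//.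
  by rewrite addr0 subnn.
Qed.

End poisson_increments.

(** * Independence extended from cylinders to all measurable sets of paths *)

Section pi_lambda.
Context {R : realType}.

Lemma eq_measure_path_space (m1 m2 : {measure set (@path_space R) -> \bar R}) :
  (m1 setT < +oo)%E -> (forall C, cylinders C -> m1 C = m2 C) ->
  forall F, measurable F -> m1 F = m2 F.
Proof.
move=> m1oo m12 F mF.
apply: (@measure_unique _ R (@path_space R) cylinders (fun=> setT)) => //.
- exact: setI_closed_cylinders.
- by move=> _; exact: cylindersT.
- by rewrite bigcup_const//; exists 0%N.
Qed.

(** As functions of [F], both sides are finite measures: the image under [Z] of [P] restricted to
    [G], and a multiple of [m]. They agree on a generating pi-system. *)
Lemma indep_path_space d (T : measurableType d) (P : probability T R)
    (G : set T) (Z : T -> @path_space R) (k : \bar R) : measurable G ->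
  measurable_fun setT Z -> (0 <= k)%E -> k \is a fin_num ->
  forall (m : probability (@path_space R) R),
  (forall C, cylinders C -> P (G `&` Z @^-1` C) = (k * m C)%E) ->
  forall F, measurable F -> P (G `&` Z @^-1` F) = (k * m F)%E.
Proof.
move=> mG mZ k0 kfin m PC F mF.
pose m1 := measure_function_pushforward__canonical__measure_function_Measure
  (mrestr P mG) mZ.
have fk0 : 0 <= fine k by rewrite fine_ge0.
pose m2 := measure_function_mscale__canonical__measure_function_Measure (NngNum fk0) m.
have E1 A : m1 A = P (G `&` Z @^-1` A) by rewrite setIC.
have E2 A : m2 A = (k * m A)%E by rewrite /m2 /= /mscale /= fineK.
rewrite -E1 -E2; apply: eq_measure_path_space => //.
  by rewrite E1 preimage_setT setIT (le_lt_trans (probability_le1 P mG))// ltry.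
by move=> C cC; rewrite E1 E2 PC.
Qed.

Variables (mu : probability (@path_space R) R) (r : R).
Hypothesis r_ge0 : 0 <= r.
Hypothesis mu_cylinder : forall l1 l2 : seq (R * nat),
  (forall q, q \in l1 -> 0 <= q.1) -> (forall q, q \in l2 -> 0 <= q.1) ->
  mu (stop_path r @^-1` cylinder l1 `&` shift_path r @^-1` cylinder l2) =
  (mu (stop_path r @^-1` cylinder l1) * mu (cylinder l2))%E.

(** The extension is made twice: first in [F2] with a cylinder in place of [F1], then in [F1] with
    [F2] arbitrary. *)
Lemma indep_stop_shift (F1 F2 : set (@path_space R)) :
  measurable F1 -> measurable F2 ->
  mu (stop_path r @^-1` F1 `&` shift_path r @^-1` F2) =
  (mu (stop_path r @^-1` F1) * mu F2)%E.
Proof.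
have mst := measurable_stop_path r_ge0.
have msh := measurable_shift_path r_ge0.
have mSt (F : set (@path_space R)) : measurable F ->
    measurable (stop_path r @^-1` F : set path_space).
  by move=> mF; rewrite -[X in measurable X]setTI; exact: mst.
have mSh (F : set (@path_space R)) : measurable F ->
    measurable (shift_path r @^-1` F : set path_space).
  by move=> mF; rewrite -[X in measurable X]setTI; exact: msh.
have mC (C : set (@path_space R)) : cylinders C -> measurable C.
  exact: sub_sigma_algebra.
have step1 (C F : set (@path_space R)) : cylinders C -> measurable F ->
    mu (stop_path r @^-1` C `&` shift_path r @^-1` F) =
    (mu (stop_path r @^-1` C) * mu F)%E.
  move=> cC; have mC1 := mSt _ (mC _ cC).
  apply: (indep_path_space (P := mu) mC1 msh) => //.
    exact: fin_num_measure.
  case: cC => l1 l1_ge0 -> _ [l2 l2_ge0 ->].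
  exact: mu_cylinder.
move=> mF1 mF2.
(* Through the law of the stopped path this factor becomes a probability of [F1], the form that
   [indep_path_space] asks for. *)
have muE : mu (stop_path r @^-1` F1) = distribution mu (mfun_Sub (mem_set mst)) F1 by [].
rewrite setIC muE muleC.
apply: (indep_path_space (P := mu) (mSh _ mF2) mst) => //.
  exact: fin_num_measure.
by move=> C cC; rewrite setIC step1// muleC.
Qed.

End pi_lambda.

(** * The Poisson law on path space and the independence of past and future *)

Section poisson_law.
Context {R : realType} {d : measure_display} {Omega : measurableType d}.
Variables (P : probability Omega R) (lambda : R) (N : R -> Omega -> nat).
Hypothesis N_poisson : poisson_process P lambda N.

Definition poisson_path (w : Omega) : @path_space R := N^~ w.

Lemma measurable_poisson_path : measurable_fun setT poisson_path.
Proof.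
by apply: measurable_fun_path_space => u; exact: (poisson_measurable N_poisson).
Qed.

Definition poisson_law : probability (@path_space R) R :=
  distribution P (mfun_Sub (mem_set measurable_poisson_path)).

Lemma poisson_lawE F : poisson_law F = P (poisson_path @^-1` F).
Proof. by []. Qed.

Lemma poisson_law_stop_shift r (F1 F2 : set (@path_space R)) : 0 <= r ->
  measurable F1 -> measurable F2 ->
  poisson_law (stop_path r @^-1` F1 `&` shift_path r @^-1` F2) =
  (poisson_law (stop_path r @^-1` F1) * poisson_law F2)%E.
Proof.
move=> r0; apply: indep_stop_shift => // l1 l2 l1_ge0 l2_ge0.
(* Stopping at [r] turns a cylinder into the one whose times are capped at [r]. *)
pose l1r := [seq (Num.min q.1 r, q.2) | q <- l1].
have l1rE : stop_path r @^-1` cylinder l1 = cylinder l1r.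
  apply/seteqP; split=> p /= H q.
    by move=> /mapP[q' ql1 ->] /=; exact: (H q' ql1).
  by move=> ql1; apply: (H (Num.min q.1 r, q.2)); apply/mapP; exists q.
have l1r_itv q : q \in l1r -> 0 <= q.1 <= r.
  by move=> /mapP[q' /l1_ge0 q'0 ->] /=; rewrite le_min q'0 r0/= ge_min lexx orbT.
rewrite !poisson_lawE l1rE [LHS](prob_cylinder2 N_poisson r0 l1r_itv l2_ge0).
(* Each one-sided probability is again an instance of [prob_cylinder2], with an empty list on the
   other side. *)
have -> : poisson_path @^-1` cylinder l2 =
    [set w | cylinder [::] (N^~ w) /\ cylinder l2 (shift_path 0 (N^~ w))].
  have sh0 w : shift_path 0 (N^~ w) = N^~ w.
    by apply/funext => u; rewrite /shift_path add0r (poisson_zero N_poisson) subn0.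
  by apply/seteqP; split=> w /=; [move=> H; rewrite sh0|move=> [_]; rewrite sh0].
have -> : poisson_path @^-1` cylinder l1r =
    [set w | cylinder l1r (N^~ w) /\ cylinder [::] (shift_path r (N^~ w))].
  by apply/seteqP; split=> w /= => [H|[]].
rewrite !(prob_cylinder2 N_poisson)//.
by rewrite /cylinder_prob /= mule1 mul1e.
Qed.

(** Measurability into path space is checked coordinate by coordinate, which works just as well when
    [Omega] carries the sigma-algebra generated by [N]. *)
Lemma sigma_process_poisson_path (F : set (@path_space R)) : measurable F ->
  sigma_process N (poisson_path @^-1` F).
Proof.
move=> mF; rewrite -[X in sigma_process _ X]setTI.
rewrite /sigma_process.
set G := \bigcup_(s in _) _.
have : @measurable_fun _ _ (g_sigma_algebraType G) path_space setT poisson_path.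
  apply: measurable_fun_path_space => u u0 _ B mB.
  apply: sub_sigma_algebra; exists u; first by rewrite /= in_itv/= u0.
  by exists B.
exact.
Qed.

End poisson_law.

(** * The Markov property at the observation times *)

Section restricted_law.
Context {R : realType} d d1 d2 {T : measurableType d} {T1 : measurableType d1}
  {T2 : measurableType d2}.
Variables (P : probability T R) (G : set T) (Y : T -> T1).
Hypotheses (mG : measurable G) (mY : measurable_fun setT Y).

(** A finite measure of total mass [P G]: the shape of the kernels [f], which are laws of a position
    on an event. *)
Definition restricted_law : set T1 -> \bar R := pushforward (mrestr P mG) Y.

Definition restricted_law_measure : {measure set T1 -> \bar R} :=
  measure_function_pushforward__canonical__measure_function_Measure
    (mrestr P mG) mY.

HB.instance Definition _ := isMeasure.Build _ _ _ restricted_law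
  (measure0 restricted_law_measure) (measure_ge0 restricted_law_measure)
  (@measure_semi_sigma_additive _ _ _ restricted_law_measure).

Let restricted_law_fin : fin_num_fun restricted_law.
Proof.
move=> B mB; rewrite /restricted_law /pushforward /mrestr fin_num_measure//.
by apply: measurableI => //; rewrite -[X in measurable X]setTI; exact: mY.
Qed.

HB.instance Definition _ :=
  Measure_isFinite.Build _ _ _ restricted_law restricted_law_fin.

Lemma restricted_lawE B : restricted_law_measure B = P (G `&` Y @^-1` B).
Proof. by rewrite setIC. Qed.

Variables (m : probability T2 R) (Z : T -> T2).
Hypothesis mZ : measurable_fun setT Z.
Hypothesis indep_YZ : forall B F, measurable B -> measurable F ->
  P (G `&` Y @^-1` B `&` Z @^-1` F) = (P (G `&` Y @^-1` B) * m F)%E.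

(** By independence the law of [(Y, Z)] on [G] is a product measure, and the product measure of a
    set is the integral of the measures of its sections. *)
Lemma integral_restricted_law (A : set T1) (C : set (T1 * T2)) :
  measurable A -> measurable C ->
  (\int[restricted_law_measure]_(y in A) m (xsection C y))%E =
  P (G `&` Y @^-1` A `&` [set w | C (Y w, Z w)]).
Proof.
move=> mA mC.
have mYZ : measurable_fun setT (fun w => (Y w, Z w)) by exact: measurable_fun_pair.
pose joint := measure_function_pushforward__canonical__measure_function_Measure
  (mrestr P mG) mYZ.
have mAC : measurable (C `&` (A `*` setT)).
  by apply: measurableI => //; exact: measurableX.
rewrite -[X in integral X]/restricted_law integral_mkcond.
(* The domain [A] is absorbed into the set: sections over points outside [A] become empty. *)
transitivity ((restricted_law \x m)%E (C `&` (A `*` setT))).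
  apply: eq_integral => y _; rewrite patchE /=.
  case: ifPn => [/set_mem Ay|/negP Ay]; rewrite /=.
    congr (m _); apply/seteqP; split=> z; rewrite /xsection /= !inE.
      by move=> Cz; split.
    by case.
  rewrite (_ : xsection _ _ = set0) ?measure0//.
  apply/seteqP; split=> z //; rewrite /xsection /= inE => -[_ [/= Ay' _]].
  by case: Ay; rewrite inE.
rewrite (@product_measure_unique _ _ _ _ R _ _ joint)//.
  rewrite /joint /= /pushforward /mrestr; congr (P _).
  by apply/seteqP; split=> w /= [[]]; [move=> ? [? _] ?|move=> ? ? ?].
move=> B F mB mF; rewrite -[RHS]/(restricted_law B * m F)%E restricted_lawE -indep_YZ//.
by rewrite /joint /= /pushforward /mrestr setIC -setIA; congr (P _).
Qed.

End restricted_law.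

(** * Events seen from an observation time and their splitting at the next one *)

Section scenario.
Context {R : realType}.
Implicit Types p : @path_space R.

(** Starting point and velocity may vary: the scenarios need a variable position, the conditioning
    event the random velocity [V0]. *)
Lemma measurable_stays_nonneg d (T : measurableType d) (v x : T -> R)
    (Z : T -> @path_space R) (s : R) : 0 <= s ->
  measurable_fun setT v -> measurable_fun setT x -> measurable_fun setT Z ->
  measurable [set w | stays_nonneg (v w) s (x w) (Z w)].
Proof.
move=> s0 mv mx mZ.
rewrite (_ : [set _ | _] = \bigcap_m \bigcap_(j in `I_m.+2)
    ((fun w => x w + v w * displacement (s / m.+1%:R * j%:R) (Z w))
       @^-1` `[0, +oo[)).
  apply: bigcap_measurableType => m _; apply: bigcap_measurableType => j _.
  rewrite -[X in measurable X]setTI.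
  suff : measurable_fun setT
      (fun w => x w + v w * displacement (s / m.+1%:R * j%:R) (Z w)).
    by apply => //; exact: measurable_itv.
  apply: measurable_funD => //; apply: measurable_funM => //.
  by apply: (measurableT_comp (measurable_displacement _)) => //; exact: grid_ge0.
apply/seteqP; split=> w /= H.
  by move=> m _ j /= jm; rewrite in_itv/= andbT; exact: H.
by move=> m j jm; have := H m I j; rewrite /= in_itv/= andbT; exact.
Qed.

Variables (v ts : nat -> R) (A : nat -> set R) (n : nat) (t : R).
Hypothesis ts_incr : forall k, (k < n)%N -> ts k < ts k.+1.
Hypothesis ts_lt : ts n < t.
Hypothesis mA : forall k, (0 < k <= n)%N -> measurable (A k).

(* [p] is the Poisson path after time [ts k], [x] the position and [v k] the
   velocity at that time. *)
Definition scenario (k : nat) (x : R) : set (@path_space R) :=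
  [set p | (forall j, (k < j <= n)%N ->
              A j (x + v k * displacement (ts j - ts k) p) /\
              v k * path_sign p (ts j - ts k) = v j) /\
           stays_nonneg (v k) (t - ts k) x p].

Lemma times_le j k : (j <= k)%N -> (k <= n)%N -> ts j <= ts k.
Proof.
move=> jk; rewrite -(subnK jk); elim: (k - j)%N => [//|i IH].
rewrite addSn => ijn; apply: (le_trans (IH (ltnW ijn))).
exact/ltW/ts_incr.
Qed.

Lemma times_le_horizon j : (j <= n)%N -> ts j <= t.
Proof. by move=> jn; apply: le_trans (times_le jn (leqnn n)) (ltW ts_lt). Qed.

Lemma measurable_scenario k : (k <= n)%N ->
  measurable [set z : R * @path_space R | scenario k z.1 z.2].
Proof.
move=> kn; pose F j : set (R * @path_space R) := [set z |
  A j (z.1 + v k * displacement (ts j - ts k) z.2) /\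
  v k * path_sign z.2 (ts j - ts k) = v j].
rewrite (_ : [set _ | _] = (\bigcap_(j in [set j | (k < j <= n)%N]) F j) `&`
    [set z : R * @path_space R | stays_nonneg (v k) (t - ts k) z.1 z.2]).
  apply: measurableI; last first.
    apply: (measurable_stays_nonneg (v := cst (v k))) => //.
    by rewrite subr_ge0 times_le_horizon.
  apply: bigcap_measurableType => j /andP[kj jn].
  have tkj : 0 <= ts j - ts k by rewrite subr_ge0 times_le// ltnW.
  apply: measurableI; rewrite -[X in measurable X]setTI.
    suff : measurable_fun setT (fun z : R * @path_space R =>
        z.1 + v k * displacement (ts j - ts k) z.2).
      by apply => //; apply: mA; rewrite jn (leq_trans _ kj).
    apply: measurable_funD => //; apply: measurable_funM => //.
    exact: (measurableT_comp (measurable_displacement _)).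
  suff : measurable_fun setT (fun z : R * @path_space R =>
      v k * path_sign z.2 (ts j - ts k)).
    by move=> /(_ measurableT [set v j]); apply; exact: measurable_set1.
  apply: measurable_funM => //.
  exact: (measurableT_comp (measurable_path_sign_coord _)).
by apply/seteqP; split=> z.
Qed.

Lemma xsection_scenario k x :
  xsection [set z : R * @path_space R | scenario k z.1 z.2] x = scenario k x.
Proof. by apply/seteqP; split=> p; rewrite /xsection /= inE. Qed.

Lemma measurable_scenario_at k x : (k <= n)%N -> measurable (scenario k x).
Proof.
by move=> kn; rewrite -xsection_scenario; apply: measurable_xsection;
  exact: measurable_scenario.
Qed.

(* The part of [scenario k x] up to time [ts k.+1] that does not involve
   [A k.+1]. *)
Definition leg (k : nat) (x : R) : set (@path_space R) :=
  [set p | v k * path_sign p (ts k.+1 - ts k) = v k.+1 /\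
           stays_nonneg (v k) (ts k.+1 - ts k) x p].

(** At the end of the leg the motion restarts from the position reached, with velocity [v k.+1] and
    the recentred path. The constraints up to that time go to the leg and to [A k.+1], all later
    ones to the new scenario. *)
Lemma scenarioS k x p : (k < n)%N -> nondecreasing_path p ->
  scenario k x p <->
  [/\ leg k x p,
      A k.+1 (x + v k * displacement (ts k.+1 - ts k) p)
    & scenario k.+1 (x + v k * displacement (ts k.+1 - ts k) p)
        (shift_path (ts k.+1 - ts k) p)].
Proof.
move=> kn np; set r := ts k.+1 - ts k.
have r0 : 0 <= r by rewrite subr_ge0 ltW// ts_incr.
have nsp := nondecreasing_shift_path np r0.
have timeE s : s - ts k = r + (s - ts k.+1) by rewrite /r; ring.
(* The flow property of the motion, valid once the velocity at the end of the leg is [v k.+1]. *)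
have posE u : 0 <= u -> v k * path_sign p r = v k.+1 ->
    x + v k * displacement (r + u) p =
    x + v k * displacement r p + v k.+1 * displacement u (shift_path r p).
  move=> u0 <-; rewrite (displacementE np (addr_ge0 r0 u0)) (displacementE np r0).
  rewrite (displacementE nsp u0) (sign_integral_split np r0 u0).
  ring.
have signE u : 0 <= u -> v k * path_sign p r = v k.+1 ->
    v k * path_sign p (r + u) = v k.+1 * path_sign (shift_path r p) u.
  by move=> u0 <-; rewrite sign_shift_path// mulrA.
have tk1 : 0 <= t - ts k.+1 by rewrite subr_ge0 times_le_horizon.
have tk : 0 <= t - ts k by rewrite subr_ge0 times_le_horizon// ltnW.
have tsj j : (k.+1 < j <= n)%N -> 0 <= ts j - ts k.+1.
  by move=> /andP[kj jn]; rewrite subr_ge0 times_le// ltnW.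
have rt : r <= t - ts k by rewrite (timeE t) lerDl.
split.
- move=> [H S]; have [|HA Hv] := H k.+1 _; first by rewrite ltnSn.
  move/(stays_nonnegP _ _ np tk) : S => S; split=> //.
    split=> //; apply/stays_nonnegP => // u /andP[u0 ur]; apply: S.
    by rewrite u0 (le_trans ur).
  split.
    move=> j kj; have [] := H j _; first by case/andP: kj => /ltnW -> ->.
    by rewrite timeE posE ?tsj// signE ?tsj.
  apply/stays_nonnegP => // u /andP[u0 ut].
  rewrite -(displacementE nsp u0) -(posE _ u0 Hv).
  rewrite (displacementE np (addr_ge0 r0 u0)); apply: S.
  by rewrite addr_ge0//= (timeE t) lerD2l.
- move=> [[Hv S1] HA [H S2]]; split.
    move=> j /andP[]; rewrite leq_eqVlt => /predU1P[<- _ //|kj jn].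
    have [|H1 H2] := H j _; first by rewrite kj.
    by rewrite timeE posE ?signE ?tsj ?kj.
  apply/stays_nonnegP => // u /andP[u0 ut].
  have [ur|/ltW ru] := leP u r.
    by move/(stays_nonnegP _ _ np r0) : S1; apply; rewrite u0.
  have ur0 : 0 <= u - r by rewrite subr_ge0.
  move/(stays_nonnegP _ _ nsp tk1) : S2 => /(_ (u - r)).
  rewrite ur0 lerBlDl -timeE ut => /(_ isT).
  rewrite -(displacementE nsp ur0) -(posE _ ur0 Hv).
  rewrite (displacementE np (addr_ge0 r0 ur0)).
  by rewrite [r + _]addrC subrK.
Qed.

(** A leg depends on the path up to its end only; this is what makes it independent of the recentred
    path. *)
Lemma leg_stop k x p : (k < n)%N ->
  leg k x (stop_path (ts k.+1 - ts k) p) = leg k x p.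
Proof.
move=> kn; have r0 : 0 <= ts k.+1 - ts k by rewrite subr_ge0 ltW// ts_incr.
by rewrite /leg /= stays_nonneg_stop// /path_sign /stop_path minxx.
Qed.

Lemma measurable_leg k x : (k < n)%N -> measurable (leg k x).
Proof.
move=> kn; have r0 : 0 <= ts k.+1 - ts k by rewrite subr_ge0 ltW// ts_incr.
apply: measurableI.
  rewrite -[X in measurable X]setTI.
  suff : measurable_fun setT (fun p => v k * path_sign p (ts k.+1 - ts k)).
    by move=> /(_ measurableT [set v k.+1]); apply; exact: measurable_set1.
  by apply: measurable_funM => //; exact: measurable_path_sign_coord.
exact: (measurable_stays_nonneg (v := cst (v k)) (x := cst x)).
Qed.

End scenario.

(** * Kernels and iterated integrals as probabilities of Poisson paths *)

Section markov.
Context {R : realType} {d : measure_display} {Omega : measurableType d}.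
Variables (P : probability Omega R) (lambda : R) (N : R -> Omega -> nat).
Variable V0 : {RV P >-> R}.
Hypothesis N_poisson : poisson_process P lambda N.
Hypothesis V0_N_independent :
  independent_systems P (sigma_rv V0) (sigma_process N).

Local Notation path_of := (poisson_path N).
Local Notation mu := (poisson_law N_poisson).

Lemma nondecreasing_poisson_path w : nondecreasing_path (path_of w).
Proof. exact: poisson_path_nondecreasing N_poisson w. Qed.

Lemma velocityE s w : velocity N V0 s w = V0 w * path_sign (path_of w) s.
Proof. by []. Qed.

Lemma velocity0 w : velocity N V0 0 w = V0 w.
Proof. by rewrite /velocity (poisson_zero N_poisson) expr0 mulr1. Qed.

Lemma telegraph_sign_integral s w :
  telegraph N V0 s w = V0 w * sign_integral (path_of w) 0 s.
Proof.
rewrite /telegraph -[LHS]/(\int[lebesgue_measure]_(u in `[0, s])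
  (V0 w * path_sign (path_of w) u)) RintegralZl//.
exact: (@integrable_path_sign _ (path_of w) `[0, s] 0 s (lexx 0) _
  (nondecreasing_poisson_path w)).
Qed.

Lemma telegraph_displacement s w : 0 <= s ->
  telegraph N V0 s w = V0 w * displacement s (path_of w).
Proof.
by move=> s0; rewrite telegraph_sign_integral displacementE//; exact: nondecreasing_poisson_path.
Qed.

Lemma sign_integral_0 (p : R -> nat) : sign_integral p 0 0 = 0.
Proof. by rewrite /sign_integral set_itv1 Rintegral_set1. Qed.

Lemma le_min_telegraph x s w : 0 <= s ->
  - x <= min_telegraph N V0 s w <-> stays_nonneg (V0 w) s x (path_of w).
Proof.
move=> s0; rewrite (stays_nonnegP _ _ (nondecreasing_poisson_path w) s0).
split=> [xm u u0s|H].
  rewrite -lerBlDl sub0r -telegraph_sign_integral.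
  apply: (le_trans xm); apply: ge_inf; last by exists u => //=; rewrite in_itv.
  (* To compare [inf] with a member, the set must be bounded below; the constant speed [|V0 w|]
     gives the bound. *)
  exists (- (`|V0 w| * s)) => _ [z /= + <-]; rewrite in_itv/= => /andP[z0 zs].
  rewrite telegraph_sign_integral.
  have := sign_integral_lip (nondecreasing_poisson_path w) (lexx 0) z0.
  rewrite sign_integral_0 !subr0 => zlip.
  rewrite lerNl; apply: (le_trans (ler_norm _)); rewrite normrN normrM.
  by rewrite ler_wpM2l// (le_trans zlip).
apply: lb_le_inf.
  by exists (telegraph N V0 0 w); exists 0 => //=; rewrite in_itv/= lexx.
move=> _ [u /= + <-]; rewrite in_itv/= => u0s.
by rewrite telegraph_sign_integral -subr_ge0 opprK addrC; exact: H.
Qed.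

Lemma measurable_V0_eq (v : R) : measurable [set w | V0 w = v].
Proof.
rewrite -[X in measurable X]setTI.
exact: (measurable_funPT V0 measurableT [set v] (measurable_set1 v)).
Qed.

Lemma measurable_path_preimage (F : set (@path_space R)) :
  measurable F -> measurable (path_of @^-1` F).
Proof.
move=> mF; rewrite -[X in measurable X]setTI.
exact: (measurable_poisson_path N_poisson).
Qed.

Lemma prob_V0_path (v : R) (F : set (@path_space R)) : measurable F ->
  P ([set w | V0 w = v] `&` path_of @^-1` F) =
  (P (V0 @^-1` [set v]) * mu F)%E.
Proof.
move=> mF; rewrite poisson_lawE; apply: V0_N_independent; last first.
  exact: sigma_process_poisson_path.
by exists [set v] => //; rewrite setTI.
Qed.

Lemma div_half (x : \bar R) : (x / (2^-1)%:E = x * 2%:E)%E.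
Proof. by rewrite inver invr_eq0 pnatr_eq0/= invrK. Qed.

(** Once the initial velocity is fixed, [X] is an event of the path alone, and by independence the
    probability 1/2 of [v] cancels. *)
Lemma cond_prob_path (v : R) (X : set Omega) (F : set (@path_space R)) :
  P (V0 @^-1` [set v]) = (2^-1)%:E -> measurable F ->
  (forall w, V0 w = v -> X w <-> F (path_of w)) ->
  cond_prob P X [set w | velocity N V0 0 w = v] = mu F.
Proof.
move=> Pv mF XF; rewrite /cond_prob.
under eq_set do rewrite velocity0.
have -> : X `&` [set w | V0 w = v] = [set w | V0 w = v] `&` path_of @^-1` F.
  by apply/seteqP; split=> w /= [] H1 H2; split=> //; apply/(XF w).
rewrite prob_V0_path// [X in (_ / X)%E]Pv div_half Pv muleAC.
by rewrite -EFinM mulVf ?mul1e.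
Qed.

Lemma m_probE v x s : 0 <= s -> P (V0 @^-1` [set v]) = (2^-1)%:E ->
  m_prob P N V0 v (- x) s = mu (stays_nonneg v s x).
Proof.
move=> s0 Pv; apply: cond_prob_path => //.
  exact: (measurable_stays_nonneg (v := cst v) (x := cst x)).
by move=> w <-; exact: le_min_telegraph.
Qed.

Variables (v ts : nat -> R) (A : nat -> set R) (n : nat) (t : R).
Hypothesis ts_incr : forall k, (k < n)%N -> ts k < ts k.+1.
Hypothesis ts_lt : ts n < t.
Hypothesis mA : forall k, (0 < k <= n)%N -> measurable (A k).
Hypothesis Pv : forall k, (k <= n)%N -> P (V0 @^-1` [set v k]) = (2^-1)%:E.

Local Notation leg := (leg v ts).
Local Notation scenario := (scenario v ts A n t).

Definition leg_end (k : nat) (x : R) (p : @path_space R) : R :=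
  x + v k * displacement (ts k.+1 - ts k) p.

Lemma leg_duration k : (k < n)%N -> 0 <= ts k.+1 - ts k.
Proof. by move=> kn; rewrite subr_ge0 ltW// ts_incr. Qed.

Lemma measurable_leg_end k x : (k < n)%N -> measurable_fun setT (leg_end k x).
Proof.
move=> kn; apply: measurable_funD => //; apply: measurable_funM => //.
exact: (measurable_displacement (leg_duration kn)).
Qed.

(** Leg and end position are determined by the stopped path, so the independence of stopped and
    recentred paths applies. *)
Lemma indep_leg k x (B : set R) (F : set (@path_space R)) : (k < n)%N ->
  measurable B -> measurable F ->
  mu (leg k x `&` leg_end k x @^-1` B `&`
      shift_path (ts k.+1 - ts k) @^-1` F) =
  (mu (leg k x `&` leg_end k x @^-1` B) * mu F)%E.
Proof.
move=> kn mB mF; have r0 := leg_duration kn.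
have -> : leg k x `&` leg_end k x @^-1` B =
    stop_path (ts k.+1 - ts k) @^-1` (leg k x `&` leg_end k x @^-1` B).
  apply/seteqP; split=> p /=; rewrite (leg_stop _ ts_incr)// /leg_end;
  by rewrite displacement_stop.
apply: poisson_law_stop_shift => //; apply: measurableI.
  exact: (measurable_leg v ts_incr).
by rewrite -[X in measurable X]setTI; exact: measurable_leg_end.
Qed.

(** The Markov property at time [ts k.+1]: the recentred path is independent of the leg and its end
    position, and [scenarioS] glues the two parts. *)
Lemma integral_leg k x (kn : (k < n)%N) :
  (\int[restricted_law_measure mu (measurable_leg v ts_incr x kn) (measurable_leg_end x kn)]_(y
      in A k.+1) mu (scenario k.+1 y))%E = mu (scenario k x).
Proof.
have r0 := leg_duration kn.
have mS := measurable_scenario v ts_incr ts_lt mA kn.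
have mAk : measurable (A k.+1) by exact: mA.
under eq_integral do rewrite -xsection_scenario.
rewrite (integral_restricted_law (measurable_leg v ts_incr x kn)
  (measurable_leg_end x kn) (measurable_shift_path r0))//; last first.
  by move=> B F; exact: indep_leg.
(* [scenarioS] concerns nondecreasing paths, so the two events are compared in [Omega], where every
   path of [N] is of this kind. *)
rewrite !poisson_lawE; congr (P _); apply/seteqP; split=> w /=.
  move=> [[H1 H2] H3].
  by apply: (proj2 (scenarioS v A ts_incr ts_lt x kn (nondecreasing_poisson_path w))).
by move=> /(proj1 (scenarioS v A ts_incr ts_lt x kn (nondecreasing_poisson_path w)))[].
Qed.

(** The factor 2 is the inverse of the probability of the initial velocity. [B] is an arbitrary set,
    so that the kernel can be identified with a measure as a set function. *)
Lemma f_kernelE k x (B : set R) : (k < n)%N ->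
  f_kernel P N V0 (v k) (v k.+1) (ts k.+1 - ts k) x B =
  (2%:E * P ([set w | V0 w = v k] `&` path_of @^-1` leg k x `&`
            (leg_end k x \o path_of) @^-1` B))%E.
Proof.
move=> kn; rewrite /f_kernel /pushforward /f_meas /cond_prob.
under [X in (_ / P X)%E]eq_set do rewrite velocity0.
rewrite [X in (_ / X)%E](Pv (ltnW kn)) div_half muleC; congr (_ * P _)%E.
have r0 := leg_duration kn.
apply/seteqP; split=> w /=.
- rewrite velocity0 => -[[Bw vw /(le_min_telegraph _ _ r0) mw] Vk].
  rewrite -Vk; split; first split => //.
    by split; [rewrite -Vk -velocityE|rewrite -Vk].
  by rewrite /leg_end -Vk -telegraph_displacement.
- rewrite /leg_end => -[[Vk [vw mw]] Bw]; rewrite velocity0; split=> //.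
  rewrite -Vk in Bw vw mw; split.
  + by rewrite telegraph_displacement.
  + by rewrite velocityE.
  + exact/(le_min_telegraph _ _ r0).
Qed.

(** The kernel is twice a law on [Omega] restricted to [V0 = v k]; independence of [V0] and the path
    turns it into a law on path space. *)
Lemma integral_f_kernel k x (f : R -> \bar R) (kn : (k < n)%N) :
  (\int[f_kernel P N V0 (v k) (v k.+1) (ts k.+1 - ts k)%R x]_(y in A k.+1) f y =
   \int[restricted_law_measure mu (measurable_leg v ts_incr x kn) (measurable_leg_end x kn)]_(y
      in A k.+1) f y)%E.
Proof.
have mG : measurable ([set w | V0 w = v k] `&` path_of @^-1` leg k x).
  apply: measurableI; first exact: measurable_V0_eq.
  by apply: measurable_path_preimage; exact: (measurable_leg v ts_incr).
have mY : measurable_fun setT (leg_end k x \o path_of).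
  apply: (measurableT_comp (measurable_leg_end x kn)).
  exact: (measurable_poisson_path N_poisson).
pose law := restricted_law_measure P mG mY.
pose law' := restricted_law_measure mu
  (measurable_leg v ts_incr x kn) (measurable_leg_end x kn).
pose two : {nonneg R} := NngNum (ler0n R 2).
pose K := measure_function_mscale__canonical__measure_function_Measure two law.
have -> : f_kernel P N V0 (v k) (v k.+1) (ts k.+1 - ts k) x = K.
  by apply/funext => B; rewrite f_kernelE// -restricted_lawE.
apply: (@eq_measure_integral _ _ _ _ law' K) => B mB _.
have mYB : measurable (leg_end k x @^-1` B).
  by rewrite -[X in measurable X]setTI; exact: measurable_leg_end.
rewrite -[RHS]/(law' B) restricted_lawE.
rewrite -[LHS]/(2%:E * law B)%E restricted_lawE -setIA.
rewrite -[X in _ `&` X]/(path_of @^-1` (leg k x `&` leg_end k x @^-1` B)).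
rewrite prob_V0_path; last first.
  by apply: measurableI => //; exact: (measurable_leg v ts_incr).
by rewrite (Pv (ltnW kn)) muleA -EFinM mulfV ?mul1e.
Qed.

(** Induction on the number [m] of remaining integrations: [integral_leg] performs the outermost
    one, and the constant [b], later the value of [m_prob] at time [t], is pulled out. *)
Lemma iter_integral_scenario (b : R) m k x : 0 < b -> (k + m)%N = n ->
  iter_integral
    (fun k x => f_kernel P N V0 (v k.-1) (v k) (ts k - ts k.-1) x) A
    (fun x => m_prob P N V0 (v n) (- x) (t - ts n) / b%:E)%E k m x =
  (mu (scenario k x) * b^-1%:E)%E.
Proof.
move=> b0; elim: m k x => [|m IH] k x; rewrite ?addn0 => kmn /=.
  rewrite kmn m_probE ?Pv// ?inver ?gt_eqF//; last by rewrite subr_ge0 ltW.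
  (* At [k = n] no observation time remains, and the scenario reduces to nonnegativity. *)
  congr (mu _ * _)%E; apply/seteqP; split=> p /=; last by case.
  by move=> H; split=> // j /andP[nj /(leq_trans nj)]; rewrite ltnn.
have kn : (k < n)%N by rewrite -kmn addnS ltnS leq_addr.
rewrite integral_f_kernel.
under eq_integral do rewrite IH ?addSnnS//.
pose law' := restricted_law_measure mu
  (measurable_leg v ts_incr x kn) (measurable_leg_end x kn).
rewrite (@ge0_integralZr _ _ _ law')//; last 3 first.
- by apply: mA.
- apply: measurable_funTS.
  under eq_fun do rewrite -xsection_scenario.
  apply: measurable_fun_xsection.
  exact: (measurable_scenario v ts_incr ts_lt mA kn).
- by rewrite lee_fin invr_ge0 ltW.
by rewrite integral_leg.
Qed.

End markov.

(** * Sign of the initial velocity *)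

(** The Riemann sum with a single cell is exact here, since its error bound is proportional to the
    number of jumps. *)
Lemma sign_integral_zero_path {R : realType} (p : R -> nat) (u : R) :
  nondecreasing_path p -> 0 <= u -> p u = 0%N -> sign_integral p 0 u = u.
Proof.
move=> np u0 pu; have := riemann_error 1 np (lexx 0) u0.
have p0 : p 0 = 0%N by apply/eqP; rewrite -leqn0 -pu np.
rewrite big_ord1 mulr1 add0r pu p0 subrr mulr0 normr_le0 subr_eq0 => /eqP->.
by rewrite /path_sign pu expr0 mulr1.
Qed.

Section telegraph_sign.
Context {R : realType} {d : measure_display} {Omega : measurableType d}.
Variables (P : probability Omega R) (lambda c : R) (N : R -> Omega -> nat).
Variable V0 : {RV P >-> R}.
Hypotheses (lambda_gt0 : 0 < lambda) (c_gt0 : 0 < c).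
Hypothesis N_poisson : poisson_process P lambda N.
Hypothesis V0_uniform : uniform_pm P c V0.
Variable t : R.
Hypothesis t_gt0 : 0 < t.

Local Notation path_of := (poisson_path N).
Local Notation mu := (poisson_law N_poisson).

(** By right-continuity a path has no jump during a short time after 0, and meanwhile the process
    moves below 0 with velocity [- c]. *)
Lemma telegraph_neg_start w : V0 w = - c -> ~ (0 <= min_telegraph N V0 t w).
Proof.
move=> Vw; have nd := nondecreasing_poisson_path N_poisson w.
rewrite -[X in X <= _]oppr0 => /(le_min_telegraph V0 N_poisson _ _ (ltW t_gt0)).
move/(stays_nonnegP _ _ nd (ltW t_gt0)) => H.
have := @poisson_right_continuous _ _ _ _ _ _ N_poisson w 0 (lexx 0).
rewrite (poisson_zero N_poisson) => /cvgrPdist_lt/(_ 1 ltr01) near0.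
have [u [u0 ut Nu]] : exists u, [/\ 0 < u, u <= t & N u w = 0%N].
  near (0 : R)^'+ => u; exists u; split => //.
    by near: u; exact: nbhs_right_le.
  have : `|0%:R - (N u w)%:R| < 1 :> R by near: u; exact: near0.
  by rewrite sub0r normrN normr_nat (ltr_nat R _ 1) ltnS leqn0 => /eqP.
have := H u; rewrite (ltW u0) ut => /(_ isT).
rewrite (sign_integral_zero_path nd (ltW u0) Nu) add0r Vw mulNr oppr_ge0.
by rewrite leNgt mulr_gt0.
Unshelve. all: by end_near. Qed.

(** The start [- c] is incompatible with [X], and the two atoms of mass 1/2 leave probability zero
    for values of [V0] other than [c] and [- c]. *)
Lemma prob_start_positive (X : set Omega) : measurable X ->
  X `<=` [set w | 0 <= min_telegraph N V0 t w] ->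
  P X = P ([set w | V0 w = c] `&` X).
Proof.
move=> mX Xmin; have mV v := measurable_V0_eq V0 v.
have [Pc Pnc] := V0_uniform.
rewrite (measureDI P mX (mV c)) [X in (X + _)%E](_ : _ = 0%E) ?add0e 1?setIC//.
pose B := [set w | V0 w = c] `|` [set w | V0 w = - c].
have mB : measurable B by exact: measurableU.
have PB0 : P (~` B) = 0%E.
  rewrite probability_setC// measureU//.
    rewrite [X in (_ - (X + _))%E]Pc [X in (_ - (_ + X))%E]Pnc -EFinD.
    by congr _%:E; lra.
  apply/seteqP; split=> w //= [Vc Vnc].
  by move: c_gt0; lra.
apply: (subset_measure0 (B := ~` B)) => //.
- exact: measurableD.
- exact: measurableC.
- move=> w [Xw /= Vc] [//|Vnc].
  exact: telegraph_neg_start Vnc (Xmin w Xw).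
Qed.

(* The inverse of [0] in [\bar R] is [+oo]: dividing by this probability inside
   the integrals is harmless only because it is positive. *)
Lemma poisson_law_stays_gt0 : (0 < mu (stays_nonneg c t 0))%E.
Proof.
have t0 := ltW t_gt0.
have mS : measurable (stays_nonneg c t 0).
  exact: (measurable_stays_nonneg (v := cst c) (x := cst 0)).
have mN : measurable [set p : @path_space R | p t = 0%N].
  rewrite -[X in measurable X]setTI.
  by apply: (measurable_coord t0 measurableT (Y := [set 0%N])).
(* A path without jumps up to [t] moves at constant velocity [c], and such paths have probability
   [expR (- (lambda * t))]. *)
apply: (@lt_le_trans _ _ (mu [set p | p t = 0%N])).
  rewrite poisson_lawE.
  have -> : path_of @^-1` [set p | p t = 0%N] =
      increment N 0 t @^-1` [set 0%N].
    apply/seteqP; split=> w /=;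
    by rewrite /increment (poisson_zero N_poisson) subn0.
  rewrite (poisson_increment_law N_poisson _ (lexx 0) t_gt0) lte_fin subr0.
  by rewrite /poisson_pmf (mulr_gt0 lambda_gt0 t_gt0) expr0 fact0 invr1 !mul1r expR_gt0.
rewrite !poisson_lawE; apply: le_measure; rewrite ?inE.
- exact: (measurable_path_preimage N_poisson mN).
- exact: (measurable_path_preimage N_poisson mS).
move=> w /= Nt; have nd := nondecreasing_poisson_path N_poisson w.
apply/(stays_nonnegP _ _ nd t0) => u /andP[u0 ut].
rewrite (sign_integral_zero_path nd u0) ?add0r ?mulr_ge0// ?(ltW c_gt0)//.
by apply/eqP; rewrite -leqn0 -Nt nd.
Qed.

End telegraph_sign.

(** * Velocity sequences and the final summation *)

Lemma vel_inj {R : realType} (c : R) : 0 < c -> injective (vel c).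
Proof. by move=> c0 [] [] //= H; exfalso; lra. Qed.

Section velocities.
Context {R : realType} (c : R) (n : nat).

(** Index 0 holds the initial velocity [c], so entry [i] of [e] belongs to time [ts i.+1]. *)
Definition velocities (e : n.-tuple bool) (k : nat) : R :=
  nth 0 (c :: [seq vel c b | b <- e]) k.

Lemma velocitiesS e (i : 'I_n) : velocities e i.+1 = vel c (tnth e i).
Proof. by rewrite /velocities /= (nth_map false) ?size_tuple// (tnth_nth false). Qed.

Lemma velocities_pm e k : (k <= n)%N ->
  velocities e k = c \/ velocities e k = - c.
Proof.
case: k => [|k] kn; first by left.
by rewrite (velocitiesS e (Ordinal kn)); case: (tnth e (Ordinal kn)); [left|right].
Qed.

End velocities.

Theorem theorem2p1 (R : realType) (d : measure_display)
    (Omega : measurableType d) (P : probability Omega R) (lambda c : R)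
    (N : R -> Omega -> nat) (V0 : {RV P >-> R})
    (lambda_gt0 : 0 < lambda) (c_gt0 : 0 < c)
    (N_poisson : poisson_process P lambda N)
    (V0_uniform : uniform_pm P c V0)
    (V0_N_independent :
       independent_systems P (sigma_rv V0) (sigma_process N))
    (t : R) (t_gt0 : 0 < t) (n : nat) (ts : nat -> R)
    (ts0 : ts 0%N = 0)
    (ts_incr : forall k, (k < n)%N -> ts k < ts k.+1)
    (ts_lt : ts n < t)
    (A : nat -> set R)
    (mA : forall k, (0 < k <= n)%N -> measurable (A k)) :
  cond_prob P
    [set w | forall k, (0 < k <= n)%N -> A k (telegraph N V0 (ts k) w)]
    [set w | 0 <= min_telegraph N V0 t w]
  = (\sum_(e : n.-tuple bool)
       let v k := nth 0%R (c :: [seq vel c b | b <- e]) k in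
       iter_integral
         (fun k x =>
            f_kernel P N V0 (v k.-1) (v k) (ts k - ts k.-1)%R x)
         A
         (fun x => m_prob P N V0 (v n) (- x)%R (t - ts n)%R
                   / m_prob P N V0 c 0%R t)
         0 n 0%R)%E.
Proof.
have t0 := ltW t_gt0; have [Pc Pnc] := V0_uniform.
pose mu := poisson_law N_poisson.
have mS : measurable (stays_nonneg c t 0).
  exact: (measurable_stays_nonneg (v := cst c) (x := cst 0)).
have mE : m_prob P N V0 c 0 t = mu (stays_nonneg c t 0).
  by rewrite -[X in m_prob _ _ _ _ X]oppr0 (m_probE N_poisson V0_N_independent).
pose b := fine (mu (stays_nonneg c t 0)).
have bE : mu (stays_nonneg c t 0) = b%:E by rewrite fineK// fin_num_measure.
have b_gt0 : 0 < b.
  by rewrite -lte_fin -bE (poisson_law_stays_gt0 lambda_gt0 c_gt0).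
have ts_ge0 k : (k <= n)%N -> 0 <= ts k.
  by move=> kn; rewrite -ts0; exact: (times_le ts_incr).
have Pv (e : n.-tuple bool) k : (k <= n)%N ->
    P (V0 @^-1` [set velocities c e k]) = (2^-1)%:E.
  by move=> kn; case: (velocities_pm c e kn) => ->.
pose S (e : n.-tuple bool) := scenario (velocities c e) ts A n t 0 0.
have mSe e : measurable (S e) by exact: (measurable_scenario_at _ ts_incr ts_lt mA).
(* Each iterated integral is the probability of a scenario from time 0 divided by [b]; what remains
   is to decompose the joint probability. *)
transitivity (\sum_(e : n.-tuple bool) (mu (S e) * b^-1%:E))%E; last first.
  apply: eq_bigr => e _; rewrite mE bE.
  exact/esym/(iter_integral_scenario N_poisson V0_N_independent ts_incr ts_lt
    mA (Pv e) 0 b_gt0 (add0n n)).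
rewrite -ge0_sume_distrl; last by move=> e _; exact: measure_ge0.
have mM : measurable [set w | 0 <= min_telegraph N V0 t w].
  rewrite (_ : [set _ | _] = [set w | stays_nonneg (V0 w) t 0 (poisson_path N w)]).
    apply: (measurable_stays_nonneg (x := cst 0)) => //.
    exact: (measurable_poisson_path N_poisson).
  apply/seteqP; split=> w /=; rewrite -[X in X <= _]oppr0 => H;
  exact/(le_min_telegraph V0 N_poisson _ _ t0).
have mH : measurable
    [set w | forall k, (0 < k <= n)%N -> A k (telegraph N V0 (ts k) w)].
  rewrite (_ : [set _ | _] = \bigcap_(k in [set k | (0 < k <= n)%N])
      ((fun w => V0 w * displacement (ts k) (poisson_path N w)) @^-1` A k)).
    apply: bigcap_measurableType => k kn; rewrite -[X in measurable X]setTI.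
    suff : measurable_fun setT
        (fun w => V0 w * displacement (ts k) (poisson_path N w)).
      by apply => //; exact: mA.
    apply: measurable_funM => //.
    apply: (measurableT_comp (measurable_displacement _)).
      by apply: ts_ge0; case/andP: kn.
    exact: (measurable_poisson_path N_poisson).
  apply/seteqP; split=> w /= H k kn; have := H k kn;
  by rewrite (telegraph_displacement V0 N_poisson)//; apply: ts_ge0; case/andP: kn.
(* Nonnegativity forces [V0 = c] almost surely, in numerator and denominator alike; the two factors
   1/2 cancel at the end. *)
rewrite /cond_prob (prob_start_positive c_gt0 N_poisson V0_uniform t_gt0 mM)//.
have Ec : [set w | V0 w = c] `&` [set w | 0 <= min_telegraph N V0 t w] =
    [set w | V0 w = c] `&` poisson_path N @^-1` stays_nonneg c t 0.
  apply/seteqP; split=> w /= [Vw]; rewrite -[X in X <= _]oppr0 => H; split=> //.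
    by rewrite -Vw; apply/(le_min_telegraph V0 N_poisson _ _ t0).
  by apply/(le_min_telegraph V0 N_poisson _ _ t0); rewrite Vw.
rewrite Ec (prob_V0_path N_poisson V0_N_independent)// Pc bE.
rewrite (prob_start_positive c_gt0 N_poisson V0_uniform t_gt0
  (measurableI _ _ mH mM)); last by move=> w [].
(* The joint event splits according to the velocities at the observation times. *)
pose U := \bigcup_(e in [set` index_enum (n.-tuple bool : finType)]) S e.
have EU : [set w | V0 w = c] `&`
    ([set w | forall k, (0 < k <= n)%N -> A k (telegraph N V0 (ts k) w)] `&`
     [set w | 0 <= min_telegraph N V0 t w]) =
    [set w | V0 w = c] `&` poisson_path N @^-1` U.
  apply/seteqP; split=> w /= [Vw].
    move=> [H M]; split=> //.
    (* Starting from [c], the velocity is again [c] exactly after an even number of jumps. *)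
    pose e := [tuple ~~ odd (N (ts i.+1) w) | i < n].
    exists e; first by rewrite /= mem_index_enum.
    rewrite /S; split; last first.
      rewrite ts0 subr0 -Vw; apply/(le_min_telegraph V0 N_poisson _ _ t0).
      by rewrite oppr0.
    move=> j jn; have /andP[j0 jn'] := jn; rewrite ts0 subr0 add0r.
    split; first by rewrite -Vw -(telegraph_displacement V0 N_poisson) ?ts_ge0//; exact: H.
    case: j j0 jn' {jn} => // j _ jn.
    rewrite (velocitiesS c e (Ordinal jn)) tnth_mktuple /path_sign /velocities /=.
    by rewrite /poisson_path -signr_odd; case: odd; rewrite /= ?expr1 ?expr0 ?mulr1// mulrN1.
  move=> [e _ [H M]]; split=> //; split.
    move=> k kn; have [] := H k kn.
    rewrite ts0 subr0 add0r -Vw -(telegraph_displacement V0 N_poisson)// ts_ge0//.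
    by case/andP: kn.
  rewrite -[X in X <= _]oppr0; apply/(le_min_telegraph V0 N_poisson _ _ t0).
  by move: M; rewrite ts0 subr0 -Vw.
have mU : measurable U by apply: fin_bigcup_measurable => // e _; exact: mSe.
rewrite EU (prob_V0_path N_poisson V0_N_independent)// Pc.
have -> : mu U = (\sum_(e : n.-tuple bool) mu (S e))%E.
  rewrite /U measure_fin_bigcup//.
    by rewrite -fsbig_seq// index_enum_uniq.
  (* A path determines its velocities at the observation times, so scenarios with a common path
     belong to the same sequence. *)
  apply/trivIsetP => e e' _ _ ee'; apply/seteqP; split=> p //= [[H _] [H' _]].
  move/eqP : ee'; apply; apply: eq_from_tnth => i.
  apply: (vel_inj c_gt0).
  have iin : (0 < i.+1 <= n)%N by rewrite /= ltn_ord.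
  have [_ Hi] := H i.+1 iin; have [_ Hi'] := H' i.+1 iin.
  by rewrite -!velocitiesS -Hi -Hi'.
have sfin : (\sum_(e : n.-tuple bool) mu (S e))%E \is a fin_num.
  by apply/sum_fin_numP => e _ _; rewrite fin_num_measure.
rewrite -(fineK sfin) -!EFinM inver gt_eqF ?mulr_gt0//.
by rewrite -EFinM; congr _%:E; field; rewrite ?gt_eqF.
Qed.
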